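(* (1) $\mathfrak b$ is equal to the smallest weight of an indiscrete locally finite coarse structure on $\omega$; (2) $\mathfrak b$ is equal to the smallest weight of an inseparated locally finite coarse structure on $\omega$; (3) $\mathfrak d$ is equal to the smallest weight of a large locally finite coarse structure on $\omega$; (4) $\mathsf{\Delta}$ is equal to the smallest weight of an indiscrete finitary coarse structure on $\omega$; (5) $\mathsf{\Sigma}$ is equal to the smallest weight of an inseparated finitary coarse structure on $\omega$; (6) $\mathfrak c$ is equal to the smallest weight of a large finitary coarse structure on $\omega$.
   Context: An entourage on a set $X$ is a set $E\subseteq X\times X$ containing the diagonal $\Delta_X$; $E^{-1}=\{(y,x):(x,y)\in E\}$, $EF=\{(x,z):\exists y\ (x,y)\in E,(y,z)\in F\}$, $E(x)=\{y:(x,y)\in E\}$, $E[A]=\bigcup_{a\in A}E(a)$. A coarse structure on $X$ is a family $\mathcal E$ of entourages on $X$ such that $\bigcup\mathcal E=X\times X$; for any $E,F\in\mathcal E$ there is $T\in\mathcal E$ with $EF^{-1}\subseteq T$; and every entourage contained in a member of $\mathcal E$ belongs to $\mathcal E$. A base of $\mathcal E$ is a subfamily $\mathcal B\subseteq\mathcal E$ such that each $E\in\mathcal E$ is contained in some $B\in\mathcal B$; the weight $w(\mathcal E)$ is the smallest cardinality of a base. $\mathcal E$ is locally finite if $E(x)$ is finite for all $E\in\mathcal E$, $x\in X$; finitary if $\sup_{x\in X}|E(x)|$ is finite for every $E\in\mathcal E$. A set $A\subseteq X$ is $\mathcal E$-bounded if $A\subseteq E(x)$ for some $E\in\mathcal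 E$, $x\in X$, and $\mathcal E$-unbounded otherwise; $\mathcal E$-discrete if for every $E\in\mathcal E$ the set $\{x\in A:A\cap E(x)\ne\{x\}\}$ is $\mathcal E$-bounded; $\mathcal E$-large if $E[A]=X$ for some $E\in\mathcal E$. Sets $A,B$ are $\mathcal E$-separated if $E[A]\cap E[B]$ is $\mathcal E$-bounded for every $E\in\mathcal E$. A coarse structure $\mathcal E$ for which $X$ is $\mathcal E$-unbounded is called indiscrete if each $\mathcal E$-discrete subset of $X$ is $\mathcal E$-bounded; inseparated if $X$ contains no $\mathcal E$-separated $\mathcal E$-unbounded sets $A,B$; large if every $\mathcal E$-unbounded set is $\mathcal E$-large. $[\omega]^\omega$ is the family of infinite subsets of $\omega$, $S_\omega$ the group of bijections of $\omega$, and $$\mathsf{\Delta}=\min\{|H|:H\subseteq S_\omega\wedge\forall A\in[\omega]^\omega\ \exists h\in H\ \{a\in A:a\ne h(a)\in A\}\in[\omega]^\omega\},$$ $$\mathsf{\Sigma}=\min\{|H|:H\subseteq S_\omega\wedge\forall A,B\in[\omega]^\omega\ \exists h\in H\ h[A]\cap B\in[\omega]^\omega\}.$$ $\mathfrak b$ and $\mathfrak d$ are the smallest cardinalities of an unbounded, respectively dominating, subset of $(\omega^\omega,\le^* )$ (eventual domination), and $\mathfrak c=2^{\aleph_0}$. *)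

(* Defs.v *)
From mathcomp Require Import all_boot.
From mathcomp Require Import boolp classical_sets functions cardinality.

Set Implicit Arguments.
Unset Strict Implicit.
Unset Printing Implicit Defensive.

Local Open Scope classical_set_scope.
Local Open Scope card_scope.

(* Cardinals are represented by sets, compared with #<= and #= from
   cardinality.v.  [min_card P] is a member of P of least cardinality, that is,
   a representative of the cardinal min {|H| : H in P}; the default value set0
   only occurs for empty P (see [min_cardP]). *)
Definition min_card (T : Type) (P : set (set T)) : set T :=
  xget set0 [set H | P H /\ forall H', P H' -> H #<= H'].

Lemma min_card_exists (T : Type) (P : set (set T)) :
  P !=set0 -> exists H, P H /\ forall H', P H' -> H #<= H'.
Proof.
move=> [H0 PH0].
have [[H [PH H_0]]|Pn0] := pselect (exists H, P H /\ H = set0).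
  by exists H; split=> // H' _; rewrite H_0 card_ge0.
have [t0 _] : H0 !=set0.
  by apply/set0P/eqP => H00; apply: Pn0; exists H0.
pose Q (Z : set (set T -> T)) :=
  (forall z H, Z z -> P H -> H (z H)) /\
  (forall z w H, Z z -> Z w -> P H -> z H = w H -> z = w).
have [F FQ Ftot|Z [[ZP Zinj] Zmax]] := @Zorn_bigcup _ Q.
  split=> [z H [X FX Xz]|z w H [X FX Xz] [Y FY Yw]].
    by have [+ _] := FQ _ FX; apply.
  have [XY|YX] := Ftot X Y FX FY.
    by have [_ +] := FQ _ FY; apply=> //; apply: XY.
  by have [_ +] := FQ _ FX; apply=> //; apply: YX.
have [[H [PH Hsurj]]|Nsurj] := pselect
    (exists H, P H /\ forall y, H y -> exists2 z, Z z & z H = y).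
  exists H; split=> // H' PH'; apply: (@card_le_trans _ _ _ Z).
    by apply: (card_le_trans _ (card_image_le (fun z => z H) Z));
      apply: subset_card_le => y /Hsurj[z Zz <-]; exists z.
  have inj' : {in Z &, injective (fun z : set T -> T => z H')}.
    by move=> z w /set_mem Zz /set_mem Zw /= /(Zinj _ _ _ Zz Zw); apply.
  have := inj_card_eq inj'; rewrite card_eq_le => /andP[_ le].
  apply: card_le_trans le _.
  by apply: subset_card_le => _ [z Zz <-]; exact: (ZP z H').
have new H : exists y, P H -> H y /\ forall z, Z z -> z H <> y.
  have [PH|] := pselect (P H); last by exists t0.
  apply: contrapT => Nnew; apply: Nsurj; exists H; split=> // y Hy.
  apply: contrapT => Nz; apply: Nnew; exists y => _; split=> // z Zz zHy.
  by apply: Nz; exists z.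
have [z0 z0P] := choice new.
have Zz0 : ~ Z z0 by move=> Zz; have [_ /(_ _ Zz)] := z0P _ PH0.
exfalso; apply: (Zmax (Z `|` [set z0])).
  by split=> [z|le]; [left|apply/Zz0/le; right].
split=> [z H [Zz|->] PH|z w H [Zz|->] [Zw|->] PH zw //].
- exact: (ZP z H).
- by have [] := z0P _ PH.
- exact: Zinj zw.
- by have [_ /(_ _ Zz)/(_ zw)] := z0P _ PH.
- by have [_ /(_ _ Zw)/(_ (esym zw))] := z0P _ PH.
Qed.

Lemma min_cardP (T : Type) (P : set (set T)) : P !=set0 ->
  P (min_card P) /\ forall H, P H -> min_card P #<= H.
Proof. by move=> /min_card_exists/(xgetPex set0). Qed.

Section CoarseStructures.
Variable X : Type.
Implicit Types (E F : set (X * X)) (A B : set X) (EE : set (set (X * X))).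

Definition is_entourage E := range (fun x => (x, x)) `<=` E.

(* [xsection E x] is E(x). *)
Definition entourage_image E A : set X := \bigcup_(a in A) xsection E a.

(* The library writes compositions of relations from right to left:
   (F \; E)%relation is the set of (x, z) such that (x, y) is in E and (y, z)
   is in F for some y, which is the entourage usually denoted EF. *)
Definition is_coarse_structure EE : Prop :=
  [/\ EE `<=` is_entourage,
      \bigcup_(E in EE) E = setT,
      forall E F, EE E -> EE F ->
        exists2 T, EE T & (F^-1 \; E)%relation `<=` T
    & forall E F, EE E -> is_entourage F -> F `<=` E -> EE F].

Definition is_base EE (BB : set (set (X * X))) : Prop :=
  BB `<=` EE /\ forall E, EE E -> exists2 B, BB B & E `<=` B.

Definition weight EE : set (set (X * X)) := min_card (is_base EE).

Definition locally_finite EE : Prop :=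
  forall E x, EE E -> finite_set (xsection E x).

Definition finitary EE : Prop :=
  forall E, EE E -> exists n : nat, forall x, xsection E x #<= `I_n.

Definition coarse_bounded EE A : Prop :=
  exists2 E, EE E & exists x, A `<=` xsection E x.

Definition coarse_discrete EE A : Prop :=
  forall E, EE E ->
    coarse_bounded EE [set x | A x /\ A `&` xsection E x <> [set x]].

Definition coarse_large EE A : Prop :=
  exists2 E, EE E & entourage_image E A = setT.

Definition coarse_separated EE A B : Prop :=
  forall E, EE E ->
    coarse_bounded EE (entourage_image E A `&` entourage_image E B).

Definition indiscrete EE : Prop :=
  ~ coarse_bounded EE setT /\
  forall A, coarse_discrete EE A -> coarse_bounded EE A.

Definition inseparated EE : Prop :=
  ~ coarse_bounded EE setT /\
  ~ exists A B, [/\ ~ coarse_bounded EE A, ~ coarse_bounded EE B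
                  & coarse_separated EE A B].

Definition large EE : Prop :=
  ~ coarse_bounded EE setT /\
  forall A, ~ coarse_bounded EE A -> coarse_large EE A.

(* A representative of the smallest weight of a coarse structure on X that
   satisfies C. *)
Definition min_weight (C : set (set (set (X * X)))) : set (set (X * X)) :=
  min_card [set weight EE | EE in is_coarse_structure `&` C].

End CoarseStructures.

Definition eventually_le (f g : nat -> nat) : Prop :=
  exists N, forall n, N <= n -> f n <= g n.

Definition cardinal_b : set (nat -> nat) :=
  min_card [set H | ~ exists g, forall f, H f -> eventually_le f g].

Definition cardinal_d : set (nat -> nat) :=
  min_card [set H | forall f, exists2 g, H g & eventually_le f g].

Definition cardinal_c : set (set nat) := [set: set nat].

Definition cardinal_Delta : set (nat -> nat) :=
  min_card [set H | H `<=` [set h | bijective h] /\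
    forall A, infinite_set A -> exists2 h, H h &
      infinite_set [set a | [/\ A a, a <> h a & A (h a)]]].

Definition cardinal_Sigma : set (nat -> nat) :=
  min_card [set H | H `<=` [set h | bijective h] /\
    forall A B, infinite_set A -> infinite_set B ->
      exists2 h, H h & infinite_set (h @` A `&` B)].

(* Main.v *)
Require Import Defs.
From mathcomp Require Import all_boot.
From mathcomp Require Import boolp classical_sets functions cardinality.

(** The six equalities are proved by one scheme, [min_card_weight]: a cardinal
    min {|H| : P H} equals the least weight of a coarse structure satisfying C
    as soon as each base of such a structure yields a family H with P H that is
    not larger than the base, and each H with P H generates such a structure
    with a base not larger than H.

    From families to structures.  A family S of binary relations on the natural
    numbers generates a coarse structure whose base consists of the compositions
    of finite words over S.  An infinite set S has only |S| finite words
    ([card_words], a form of the equality of k * k and k for infinite k), so the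
    weight is at most |S|; local finiteness and finitarity pass from letters to
    words.  The properties that are wanted only ask for one suitable letter.  A
    function f contributes the relation x <= y <= f x.  If A and B are infinite
    and f is not eventually below the function g sending n to a bound of one
    member of A and one of B beyond n, then infinitely many n are linked to both
    A and B by f; and if f dominates the function sending n to a member of A
    beyond n, almost all n are linked to A.  An injection contributes its graph,
    and the sets Delta and Sigma ask of the permutations just what
    indiscreteness and inseparation need.  The graphs of all injections give a
    large structure of weight at most c.

    From bases to families.  In a locally finite structure the bounded sets are
    the finite ones, and each entourage E has a nondecreasing control function
    bounding E(x) and its inverse on each initial segment.  A set whose gaps
    outgrow a common bound of all these functions would be discrete, so they are
    unbounded when the structure is indiscrete ([control_unbounded]); for large
    structures a twofold iterate of the controls is dominating
    ([control_dominating]).  In a finitary structure each entourage is covered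
    by the graphs of finitely many permutations ([entourage_bijections]), and
    the permutations found for the members of a base witness Delta or Sigma by
    the pigeonhole principle.  For the continuum, the branches of the binary
    tree form an almost disjoint family of size c, and a finitary entourage E
    can satisfy E[A] = X for finitely many members A of it only
    ([finitary_branches]).

    Large implies inseparated, which implies indiscrete, so the large structure
    of the injections also shows that all the minima range over nonempty
    classes. *)

Local Open Scope classical_set_scope.
Local Open Scope card_scope.

Set Implicit Arguments.
Unset Strict Implicit.
Unset Printing Implicit Defensive.

(** * Finite words over an infinite set *)

Lemma card_le_inj (T U : Type) (A : set T) (B : set U) (f : T -> U) :
  (forall x, A x -> B (f x)) ->
  (forall x y, A x -> A y -> f x = f y -> x = y) -> A #<= B.
Proof.
move=> fAB finj; have : $|{injfun A >-> B}|.
  apply/injfunPex; exists f => // x y /set_mem Ax /set_mem Ay.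
  exact: finj.
by case=> g; apply: (inj_card_le g).
Qed.

Lemma card_le_injP (T U : Type) (A : set T) (B : set U) : B !=set0 -> A #<= B ->
  exists f : T -> U, (forall x, A x -> B (f x)) /\
    (forall x y, A x -> A y -> f x = f y -> x = y).
Proof.
elim/Ppointed: U => U in B *; first by move=> [b]; rewrite emptyE.
move=> _ /pcard_leP/injfunPex[f fAB finj]; exists f; split=> // x y Ax Ay.
by apply: finj; apply: mem_set.
Qed.

(** The smaller of A and B is the minimum of the family {A, B}. *)
Lemma card_le_total (T : Type) (A B : set T) : A #<= B \/ B #<= A.
Proof.
have [|H [[->|->] min]] := @min_card_exists T [set A; B]; first by exists A; left.
- by left; apply: min; right.
- by right; apply: min; left.
Qed.

Fixpoint words (T : Type) (S : set T) (w : seq T) : Prop :=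
  if w is x :: w' then S x /\ words S w' else True.

Lemma words_map (T U : Type) (A : set T) (B : set U) (f : T -> U) (w : seq T) :
  (forall x, A x -> B (f x)) -> words A w -> words B (map f w).
Proof. by move=> fAB; elim: w => //= x w IH [/fAB ? /IH]. Qed.

Lemma words_map_inj (T U : Type) (A : set T) (f : T -> U) (v w : seq T) :
  (forall x y, A x -> A y -> f x = f y -> x = y) ->
  words A v -> words A w -> map f v = map f w -> v = w.
Proof.
move=> finj; elim: v w => [|x v IH] [|y w] //= [Ax Av] [Ay Aw] [fxy fvw].
by congr cons; [apply: finj | apply: IH].
Qed.

Lemma card_le_words (T U : Type) (A : set T) (B : set U) : B !=set0 ->
  A #<= B -> words A #<= words B.
Proof.
move=> B0 /(card_le_injP B0)[f [fAB finj]]; apply: (card_le_inj (f := map f)).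
  by move=> w; apply: words_map.
by move=> v w Av Aw; apply: (words_map_inj finj).
Qed.

Lemma wordsT (T : Type) (w : seq T) : words setT w.
Proof. by elim: w. Qed.

Lemma words_nseq (T : Type) (S : set T) n s : S s -> words S (nseq n s).
Proof. by move=> Ss; elim: n => //= n IH. Qed.

(** A set G of pairs (word, letter) stands for a partial map from words to
    letters; its alphabet is read off from the words of length one. *)
Definition letters (T : Type) (G : set (seq T * T)) : set T :=
  [set x | exists z, G ([:: x], z)].

(** The partial injections, from the nonempty words over a subset A of S into
    A, to which Zorn's lemma is applied.  Restricting to nonempty words makes
    the empty set a word code, so that the union of an empty chain is one. *)
Definition word_code (T : Type) (S : set T) (G : set (seq T * T)) : Prop :=
  [/\ letters G `<=` S,
      forall w z, G (w, z) -> words (letters G) w /\ letters G z,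
      forall x w, letters G x -> words (letters G) w -> exists z, G (x :: w, z)
    & forall v w z, G (v, z) -> G (w, z) -> v = w].

Lemma sub_words (T : Type) (A B : set T) (w : seq T) :
  A `<=` B -> words A w -> words B w.
Proof. by move=> AB; elim: w => //= x w IH [/AB ? /IH]. Qed.

Lemma sub_letters (T : Type) (G G' : set (seq T * T)) :
  G `<=` G' -> letters G `<=` letters G'.
Proof. by move=> GG' x [z /GG']; exists z. Qed.

Lemma word_code_bigcup (T : Type) (S : set T) (F : set (set (seq T * T))) :
  F `<=` word_code S -> total_on F subset -> word_code S (\bigcup_(G in F) G).
Proof.
move=> FP Ftot.
have lettersU x : letters (\bigcup_(G in F) G) x -> exists2 G, F G & letters G x.
  by move=> [z [G FG Gxz]]; exists G => //; exists z.
have subU G : F G -> G `<=` \bigcup_(G in F) G by move=> FG; exact: bigcup_sup.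
split.
- by move=> x /lettersU[G /FP[+ _ _ _]]; apply.
- move=> w z [G FG Gwz]; have [_ /(_ _ _ Gwz)[Gw Gz] _ _] := FP _ FG.
  have sub := sub_letters (subU _ FG).
  by split; [apply: sub_words Gw | apply: sub].
- move=> x w /lettersU[G0 FG0 G0x] Uw.
  have [G [FG Gx Gw]] : exists G, [/\ F G, letters G x & words (letters G) w].
    elim: w Uw => [_|y w IH /= [/lettersU[G1 FG1 G1y] /IH[G2 [FG2 G2x G2w]]]].
      by exists G0.
    have [le|le] := Ftot _ _ FG1 FG2.
      by exists G2; split=> //; split=> //; apply: sub_letters G1y.
    exists G1; split=> //; [exact: sub_letters G2x|split=> //].
    by apply: sub_words G2w; apply: sub_letters.
  by have [_ _ /(_ _ _ Gx Gw)[z Gz] _] := FP _ FG; exists z; exists G.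
- move=> v w z [G FG Gv] [G' FG' Gw].
  have [le|le] := Ftot _ _ FG FG'.
    by have [_ _ _] := FP _ FG'; apply; [apply: le Gv|exact: Gw].
  by have [_ _ _] := FP _ FG; apply; [exact: Gv|apply: le Gw].
Qed.

(** Prefixing a fixed letter makes every word nonempty. *)
Lemma word_code_le (T : Type) (S : set T) (G : set (seq T * T)) :
  word_code S G -> letters G !=set0 -> words (letters G) #<= letters G.
Proof.
move=> [_ Gw Gtot Ginj] [a Ga].
have /choice[c cP] w : exists z, words (letters G) w -> G (a :: w, z).
  have [/(Gtot _ _ Ga)[z Gz]|nw] := pselect (words (letters G) w).
    by exists z.
  by exists a => /nw.
apply: (card_le_inj (f := c)) => [w /cP/Gw[]//|v w /cP Gv /cP Gw' vw].
by rewrite vw in Gv; have [] := Ginj _ _ _ Gv Gw'.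
Qed.

(** The starting point: a copy of the natural numbers inside S, whose words
    are countable. *)
Lemma word_code_nat (T : Type) (S : set T) (i : nat -> T) :
  (forall n, S (i n)) -> injective i ->
  exists2 G, word_code S G & letters G !=set0.
Proof.
move=> iS iinj.
pose G : set (seq T * T) :=
  [set p | exists2 u, u != [::] & p = (map i u, i (pickle u))].
have Gi n : letters G (i n) by exists (i (pickle [:: n])), [:: n].
have GE x : letters G x -> exists n, x = i n.
  by move=> [z [[|n []] _ //= [-> _]]]; exists n.
exists G; last by exists (i 0).
split.
- by move=> x /GE[n ->].
- move=> w z [u _ [-> ->]]; split=> //.
  by apply: (@words_map _ _ setT); [|exact: wordsT].
- move=> x w /GE[n ->] Gw.
  have [u ->] : exists u, w = map i u.
    elim: w Gw => [_|y w IH [/GE[m ->] /IH[u ->]]]; first by exists [::].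
    by exists (m :: u).
  by exists (i (pickle (n :: u))), (n :: u).
- move=> v w z [u _ [-> ->]] [u' _ [-> /iinj uu']].
  by rewrite (pcan_inj pickleK uu').
Qed.

(** Words of length one code A, and words repeating one letter twice code the
    rest of B. *)
Lemma card_le_setU_words (T : Type) (A B : set T) : A !=set0 ->
  B #<= A -> A `|` B #<= words A.
Proof.
move=> A0 /(card_le_injP A0)[k [kA kinj]].
apply: (card_le_inj (f := fun x => if `[< A x >] then [:: x] else [:: k x; k x])).
  by move=> x; case: asboolP => [//|nAx [//|/kA]].
move=> x y ABx ABy; case: asboolP => Ax; case: asboolP => Ay //; first by case.
by case=> kxy _; apply: kinj kxy; [case: ABx|case: ABy].
Qed.

(** Room for a disjoint copy j(A) of the alphabet A inside S lets the code
    grow: the words over the union of A and j(A) are not more numerous than A,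
    so those that involve a letter of j(A) can be coded in j(A), away from the
    values in use. *)
Lemma word_code_extend (T : Type) (S : set T) (G : set (seq T * T)) (j : T -> T) :
  word_code S G -> letters G !=set0 ->
  (forall x, letters G x -> (S `\` letters G) (j x)) ->
  (forall x y, letters G x -> letters G y -> j x = j y -> x = y) ->
  exists2 G', G `<` G' & word_code S G'.
Proof.
move=> GP G0 jS jinj; set A := letters G in GP G0 jS jinj *.
have leA : words A #<= A by exact: word_code_le GP G0.
have [AS Gw Gtot Ginj] := GP; have [a Aa] := G0.
pose AB := A `|` j @` A.
have leAB : AB #<= words A := card_le_setU_words G0 (card_image_le j A).
have leW : words AB #<= A.
  exact: card_le_trans (card_le_words G0 (card_le_trans leAB leA)) leA.
have [c [cA cinj]] := card_le_injP G0 leW.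
have jA y : A y -> ~ A (j y) by move=> /jS[].
pose G' : set (seq T * T) := G `|`
  [set p | [/\ words AB p.1, p.1 <> [::], ~ words A p.1 & p.2 = j (c p.1)]].
have GG' : G `<=` G' by move=> p; left.
have ABS : AB `<=` S by move=> x [/AS//|[y /jS[]+ _ <-]].
have G'AB : letters G' = AB.
  apply/seteqP; split=> x.
    by move=> [z [Gx|[[]]//]]; left; exists z.
  move=> ABx; have [Ax|nAx] := pselect (A x).
    by apply: sub_letters Ax.
  by exists (j (c [:: x])); right; split=> //= -[].
exists G'.
  rewrite properEneq; split=> //; apply/eqP => GG'E.
  have : letters G' (j a) by rewrite G'AB; right; exists a.
  by rewrite -GG'E => /(jA _ Aa).
split; rewrite ?G'AB //.
- move=> w z [/Gw[ww zz]|[/= ww _ _ ->]].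
    by split; [apply: sub_words ww => x; left|left].
  by split=> //; right; exists (c w) => //; apply: cA.
- move=> x w ABx ABw; have [[Ax Aw]|nA] := pselect (words A (x :: w)).
    by have [z Gz] := Gtot _ _ Ax Aw; exists z; left.
  by exists (j (c (x :: w))); right.
- move=> v w z [Gv|[/= ABv _ _ zv]] [Gw'|[/= ABw _ _ zw]].
  + exact: Ginj Gv Gw'.
  + by have [_ Az] := Gw _ _ Gv; case: (jA (c w)); [exact: cA|rewrite -zw].
  + by have [_ Az] := Gw _ _ Gw'; case: (jA (c v)); [exact: cA|rewrite -zv].
  + apply: cinj => //; apply: jinj; [exact: cA|exact: cA|by rewrite -zv].
Qed.

(** A maximal word code has an alphabet A of the same size as S: otherwise S
    outside of A would contain a copy of A, and the code could be extended. *)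
Lemma card_words (T : Type) (S : set T) : infinite_set S -> words S #<= S.
Proof.
move=> /[dup] infS /infiniteP leNS.
have S0 := infinite_setN0 infS.
have [i [iS iinj]] := card_le_injP S0 leNS.
have [G0 G0P G00] : exists2 G, word_code S G & letters G !=set0.
  by apply: (@word_code_nat _ _ i) => [n|m n]; [exact: iS|exact: iinj].
have [G [GP Gmax]] := Zorn_bigcup (@word_code_bigcup T S).
have Gn0 : letters G !=set0.
  apply: contrapT => nG; apply: (Gmax G0) G0P; rewrite properEneq; split.
    by apply/eqP => GG0; apply: nG; rewrite GG0.
  move=> [w z] Gwz; exfalso; apply: nG; exists z.
  by have [_ /(_ _ _ Gwz)[]] := GP.
have leG := word_code_le GP Gn0; have [GS _ _ _] := GP.
have leSG : S `\` letters G #<= letters G.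
  have [D0|nD] := pselect ((S `\` letters G) !=set0); last first.
    suff -> : S `\` letters G = set0 by exact: card_ge0.
    by apply/seteqP; split=> // x Dx; apply: nD; exists x.
  have [leD|//] := card_le_total (letters G) (S `\` letters G).
  have [j [jD jinj]] := card_le_injP D0 leD.
  by have [G' /Gmax] := word_code_extend GP Gn0 jD jinj.
have {}leSG : S #<= letters G.
  apply: card_le_trans (card_le_trans (card_le_setU_words Gn0 leSG) leG).
  apply: subset_card_le => x Sx.
  by have [Gx|nGx] := pselect (letters G x); [left|right].
apply: card_le_trans (card_le_words Gn0 leSG) _.
by apply: card_le_trans leG _; apply: subset_card_le.
Qed.

(** A union of countable sets indexed by an infinite S: u is coded by the word
    repeating n + 1 times the letter s, where u is the n-th element of F s. *)
Lemma card_le_bigcup_countable (T U : Type) (S : set T) (F : T -> set U) :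
  infinite_set S -> (forall s, S s -> countable (F s)) ->
  \bigcup_(s in S) F s #<= S.
Proof.
move=> infS Fc; have [s0 Ss0] := infinite_setN0 infS.
apply: card_le_trans (card_words infS).
have /choice[e einj] s : exists e : U -> nat, S s ->
    forall u v, F s u -> F s v -> e u = e v -> u = v.
  have [Ss|nSs] := pselect (S s); last by exists (fun=> 0) => /nSs.
  have [|e [_ einj]] := card_le_injP _ (Fc _ Ss); first by exists 0.
  by exists e.
have /choice[l lP] u : exists s, (\bigcup_(s in S) F s) u -> S s /\ F s u.
  have [[s Ss Fsu]|nu] := pselect ((\bigcup_(s in S) F s) u); first by exists s.
  by exists s0 => /nu.
apply: (card_le_inj (f := fun u => nseq (e (l u) u).+1 (l u))).
  by move=> u /lP[Sl _]; exact: words_nseq.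
move=> u v /lP[Sl Fu] /lP[_ Fv] uv.
have luv : l u = l v by case: uv.
move/(congr1 size): uv; rewrite !size_nseq -luv => -[].
by apply: (einj _ Sl) => //; rewrite luv.
Qed.

Lemma infinite_bigcup (I T : Type) (D : set I) (F : I -> set T) (A : set T) :
  finite_set D -> infinite_set A -> A `<=` \bigcup_(i in D) F i ->
  exists2 i, D i & infinite_set (F i).
Proof.
move=> finD infA AF; apply: contrapT => nF; apply: infA.
apply: (sub_finite_set AF); apply: bigcup_finite => // i Di.
by apply: contrapT => nFi; apply: nF; exists i.
Qed.

(** * Infinite sets of natural numbers *)

Lemma finite_nat_bound (A : set nat) : finite_set A <->
  exists N, forall m, A m -> m <= N.
Proof.
split=> [/finite_seqP[s ->]|[N AN]].
  exists (\max_(i <- s) i) => m /= ms.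
  exact: (@leq_bigmax_seq _ s xpredT (fun i => i)).
by apply: (@sub_finite_set _ _ `I_N.+1) (finite_II _) => m /AN.
Qed.

Lemma infinite_nat_unbounded (A : set nat) : infinite_set A <->
  forall n, exists2 m, A m & n < m.
Proof.
split=> [infA n|Ainf /finite_nat_bound[N AN]].
  apply: contrapT => nm; apply/infA/finite_nat_bound; exists n => m Am.
  by rewrite leqNgt; apply/negP => nlm; apply: nm; exists m.
by have [m /AN] := Ainf N; rewrite leqNgt => /negbTE ->.
Qed.

Lemma sparse_sequence (A : set nat) (g : nat -> nat) : infinite_set A ->
  exists a : nat -> nat, (forall i, A (a i)) /\
    forall i j, i < j -> a i < a j /\ g (a i) < a j.
Proof.
move=> /infinite_nat_unbounded Aunb.
have /choice[nxt nxtP] n : exists m, A m /\ maxn n (g n) < m.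
  by have [m] := Aunb (maxn n (g n)); exists m.
have [a0 Aa0 _] := Aunb 0.
pose a i := iter i nxt a0.
have step i : a i < a i.+1 /\ g (a i) < a i.+1.
  by have [_] := nxtP (a i); rewrite gtn_max => /andP.
have lt_a i j : i < j -> a i.+1 <= a j.
  elim: j => // j IH; rewrite ltnS leq_eqVlt => /predU1P[->//|/IH le].
  exact: leq_trans le (ltnW (step j).1).
exists a; split; first by case=> [//|i]; exact: (nxtP _).1.
by move=> i j /lt_a ij; have [s1 s2] := step i; split; apply: leq_trans ij.
Qed.

Lemma increasing_inj (a : nat -> nat) :
  (forall i j, i < j -> a i < a j) -> injective a.
Proof.
move=> ainc i j aij; have [/ainc|/ainc|//] := ltngtP i j.
all: by rewrite aij ltnn.
Qed.

Lemma infinite_range (T : Type) (a : nat -> T) : injective a ->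
  infinite_set (range a).
Proof.
move=> ainj; apply/infiniteP; apply: (card_le_inj (f := a)) => [n _|m n _ _].
  by exists n.
exact: ainj.
Qed.

(** An entourage whose sections, and those of its inverse, are bounded by g links
    no two points of such a set: sparse sets are the tests for lower bounds. *)
Lemma sparse_set (g : nat -> nat) : exists2 A, infinite_set A &
  forall a b, A a -> A b -> a < b -> g a < b.
Proof.
have [a [_ aP]] := sparse_sequence g infinite_nat.
exists (range a).
  by apply/infinite_range/increasing_inj => i j /aP[].
move=> _ _ [i _ <-] [j _ <-] lt.
have [/aP[]//|/aP[]|ij] := ltngtP i j; last by rewrite ij ltnn in lt.
by move=> /(ltn_trans lt); rewrite ltnn.
Qed.

Lemma infinite_set_split (A : set nat) : infinite_set A ->
  exists B C, [/\ infinite_set B, infinite_set C, A = B `|` C & B `&` C = set0].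
Proof.
move=> infA; have [a [aA ainc]] := sparse_sequence id infA.
have ainj : injective a by apply: increasing_inj => i j /ainc[].
pose B := range (a \o double); exists B, (A `\` B); split.
- by apply: infinite_range => i j /ainj/double_inj.
- apply: (@sub_infinite_set _ (range (a \o (fun i => i.*2.+1)))).
    move=> _ [i _ <-]; split; first exact: aA.
    by move=> [j _ /ainj/(congr1 odd)]; rewrite /= !odd_double.
  by apply: infinite_range => i j /ainj[/double_inj].
- rewrite setDE setUIr setUv setIT; apply/seteqP; split=> x; first by right.
  by move=> [[i _ <-]|//]; exact: aA.
- by rewrite setDE setICA setICr setI0.
Qed.

Lemma finite_family_bounded (H : set (nat -> nat)) : finite_set H ->
  exists g, forall f, H f -> forall n, f n <= g n.
Proof.
move=> finH.
have /choice[g gP] n : exists N, forall f, H f -> f n <= N.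
  have /finite_nat_bound[N NP] := finite_image (fun f : nat -> nat => f n) finH.
  by exists N => f Hf; apply: NP; exists f.
by exists g => f Hf n; apply: gP.
Qed.

Definition unbounded_family (H : set (nat -> nat)) :=
  ~ exists g, forall f, H f -> eventually_le f g.

(** A finite family is bounded by its pointwise maximum. *)
Lemma unbounded_family_infinite H : unbounded_family H -> infinite_set H.
Proof.
move=> unbH /finite_family_bounded[g gP]; apply: unbH.
by exists g => f Hf; exists 0 => n _; apply: gP.
Qed.

Definition dominating_family (H : set (nat -> nat)) :=
  forall f, exists2 g, H g & eventually_le f g.

Lemma dominating_unbounded H : dominating_family H -> unbounded_family H.
Proof.
move=> domH [g gP]; have [f /gP[N fg] [M gf]] := domH (fun n => (g n).+1).
have := leq_trans (gf (maxn N M) (leq_maxr _ _)) (fg _ (leq_maxl _ _)).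
by rewrite ltnn.
Qed.

(** The complements of the domain and of the range are both countably infinite,
    so some bijection between them completes f. *)
Lemma extend_to_bijection (D : set nat) (f : nat -> nat) :
  (forall x y, D x -> D y -> f x = f y -> x = y) ->
  infinite_set (~` D) -> infinite_set (~` (f @` D)) ->
  exists2 h : nat -> nat, bijective h & forall x, D x -> h x = f x.
Proof.
move=> finj infD infR.
have : ~` D #= ~` (f @` D).
  apply: (@card_eq_trans _ _ _ _ [set: nat]).
    by apply: eq_card_nat => //; exact: countableP.
  by rewrite card_eq_sym; apply: eq_card_nat => //; exact: countableP.
move=> /pcard_eqP/bijPex[u [uC uinj usurj]].
pose h x := if `[< D x >] then f x else u x.
exists h; last by move=> x Dx; rewrite /h; case: asboolP.
rewrite -setTT_bijective; split=> // [x y _ _|y _].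
  rewrite /h; case: asboolP => Dx; case: asboolP => Dy.
  - exact: finj.
  - by move=> fxuy; have := uC _ Dy; rewrite -fxuy => -[]; exists x.
  - by move=> fxuy; have := uC _ Dx; rewrite fxuy => -[]; exists y.
  - by apply: uinj; apply: mem_set.
have [[x Dx <-]|/usurj[x Dx <-]] := pselect ((f @` D) y).
  by exists x => //; rewrite /h; case: asboolP.
by exists x => //; rewrite /h; case: asboolP.
Qed.

(** One bijection may not suffice, as with the successor function.  Halving an
    infinite domain leaves infinitely many points outside of each half and of
    its image, so each half extends. *)
Lemma partial_injection_cover (D : set nat) (f : nat -> nat) :
  (forall x y, D x -> D y -> f x = f y -> x = y) ->
  exists h1 h2 : nat -> nat, [/\ bijective h1, bijective h2
    & forall x, D x -> h1 x = f x \/ h2 x = f x].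
Proof.
move=> finj.
have coinf (A : set nat) : finite_set A -> infinite_set (~` A).
  by move=> finA; rewrite -setTD; exact: (infinite_setD infinite_nat).
have image_inf B C : infinite_set C -> B `&` C = set0 -> B `|` C `<=` D ->
    infinite_set (~` (f @` B)).
  move=> infC BC0 BCD; apply: (@sub_infinite_set _ (f @` C)).
    move=> _ [x Cx <-] [y By fyx]; have : (B `&` C) x; last by rewrite BC0.
    by split=> //; rewrite -(finj _ _ _ _ fyx) //; apply: BCD; [left|right].
  move=> fin; apply: infC; apply: card_le_finite fin.
  apply: (card_le_inj (f := f)) => [x Cx|x y Cx Cy]; first by exists x.
  by apply: finj; apply: BCD; right.
have [B [C [DBC [infB infC] [infB' infC']]]] : exists B C, [/\ D = B `|` C,
    infinite_set (~` B) /\ infinite_set (~` C)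
    & infinite_set (~` (f @` B)) /\ infinite_set (~` (f @` C))].
  have [finD|infD] := pselect (finite_set D).
    exists D, set0; rewrite setU0 image_set0; split=> //; split; apply: coinf => //.
    exact: finite_image.
  have [B [C [infB infC DE BC0]]] := infinite_set_split infD.
  exists B, C; split=> //; split.
  - apply: (sub_infinite_set _ infC) => x Cx Bx.
    by have : (B `&` C) x := conj Bx Cx; rewrite BC0.
  - apply: (sub_infinite_set _ infB) => x Bx Cx.
    by have : (B `&` C) x := conj Bx Cx; rewrite BC0.
  - by apply: (image_inf _ _ infC BC0); rewrite DE.
  - by apply: (image_inf _ _ infB); [rewrite setIC|rewrite setUC DE].
have finjB x y : B x -> B y -> f x = f y -> x = y.
  by move=> Bx By; apply: finj; rewrite DBC; left.
have finjC x y : C x -> C y -> f x = f y -> x = y.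
  by move=> Cx Cy; apply: finj; rewrite DBC; right.
have [h1 h1bij h1E] := extend_to_bijection finjB infB infB'.
have [h2 h2bij h2E] := extend_to_bijection finjC infC infC'.
by exists h1, h2; split=> // x; rewrite DBC => -[/h1E|/h2E]; [left|right].
Qed.

(** * Coarse structures and their controls *)

Lemma coarse_refl (X : Type) (EE : set (set (X * X))) E x :
  is_coarse_structure EE -> EE E -> E (x, x).
Proof. by move=> [EEe _ _ _] /EEe; apply; exists x. Qed.

(** The axiom on E F^-1, pointwise; symmetrization, composition and union are
    its consequences because entourages are reflexive. *)
Lemma coarse_quotient (X : Type) (EE : set (set (X * X))) E F :
  is_coarse_structure EE -> EE E -> EE F ->
  exists2 T, EE T & forall x y z, E (x, y) -> F (z, y) -> T (x, z).
Proof.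
move=> [_ _ EEq _] EEE EEF; have [T EET FET] := EEq _ _ EEE EEF.
by exists T => // x y z Exy Fzy; apply: FET; exists y.
Qed.

Lemma coarse_symmetrize (X : Type) (EE : set (set (X * X))) E :
  is_coarse_structure EE -> EE E ->
  exists2 T, EE T & forall x y, E (x, y) -> T (x, y) /\ T (y, x).
Proof.
move=> cEE EEE; have [T EET ET] := coarse_quotient cEE EEE EEE.
have Exx x : E (x, x) := coarse_refl x cEE EEE.
by exists T => // x y Exy; split; [exact: ET Exy (Exx y)|exact: ET (Exx y) Exy].
Qed.

Lemma coarse_comp (X : Type) (EE : set (set (X * X))) E F :
  is_coarse_structure EE -> EE E -> EE F ->
  exists2 T, EE T & forall x y z, E (x, y) -> F (y, z) -> T (x, z).
Proof.
move=> cEE EEE EEF; have [F' EEF' FF'] := coarse_symmetrize cEE EEF.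
have [T EET ET] := coarse_quotient cEE EEE EEF'.
by exists T => // x y z Exy /FF'[_]; apply: ET.
Qed.

Lemma coarse_union (X : Type) (EE : set (set (X * X))) E F :
  is_coarse_structure EE -> EE E -> EE F ->
  exists2 T, EE T & E `|` F `<=` T.
Proof.
move=> cEE EEE EEF; have [T EET ET] := coarse_comp cEE EEE EEF.
exists T => // -[x y] [Exy|Fxy].
  exact: ET Exy (coarse_refl y cEE EEF).
exact: ET (coarse_refl x cEE EEE) Fxy.
Qed.

Lemma weightP (X : Type) (EE : set (set (X * X))) :
  is_base EE (weight EE) /\ forall BB, is_base EE BB -> weight EE #<= BB.
Proof. by apply: min_cardP; exists EE; split=> // E EEE; exists E. Qed.

Lemma coarse_pair (X : Type) (EE : set (set (X * X))) x y :
  is_coarse_structure EE -> exists2 E, EE E & E (x, y).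
Proof.
move=> [_ /seteqP[_ EET] _ _].
by have [E EEE Exy] := EET (x, y) I; exists E.
Qed.

Lemma mem_entourage_image (X : Type) (E : set (X * X)) (A : set X) y :
  entourage_image E A y <-> exists2 a, A a & E (a, y).
Proof. by split=> -[a Aa /xsectionP Eay]; exists a. Qed.

Lemma sub_entourage_image (X : Type) (E F : set (X * X)) (A : set X) :
  E `<=` F -> entourage_image E A `<=` entourage_image F A.
Proof.
by move=> EF y /mem_entourage_image[a Aa /EF Fay]; apply/mem_entourage_image; exists a.
Qed.

Lemma coarse_segment (EE : set (set (nat * nat))) x n :
  is_coarse_structure EE -> exists2 E, EE E & forall y, y < n -> E (x, y).
Proof.
move=> cEE; elim: n => [|n [E EEE En]].
  by have [E EEE _] := coarse_pair x x cEE; exists E.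
have [F EEF Fxn] := coarse_pair x n cEE.
have [T EET EFT] := coarse_union cEE EEE EEF.
exists T => // y; rewrite ltnS leq_eqVlt => /predU1P[->|/En Exy]; apply: EFT.
  by right.
by left.
Qed.

Lemma finitary_locally_finite (EE : set (set (nat * nat))) :
  finitary EE -> locally_finite EE.
Proof. by move=> finEE E x /finEE[n /(_ x) le]; apply/finite_set_leP; exists n. Qed.

(** Finite sets are bounded in every coarse structure, because any two points
    are linked by some entourage and finite unions of entourages are
    controlled. *)
Lemma locally_finite_boundedP (EE : set (set (nat * nat))) (A : set nat) :
  is_coarse_structure EE -> locally_finite EE ->
  coarse_bounded EE A <-> finite_set A.
Proof.
move=> cEE lfEE; split=> [[E EEE [x AE]]|/finite_nat_bound[N AN]].
  exact: sub_finite_set AE (lfEE _ _ EEE).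
have [E EEE EN] := coarse_segment 0 N.+1 cEE.
by exists E => //; exists 0 => y /AN leyN; apply/xsectionP/EN.
Qed.

Lemma locally_finite_unbounded (EE : set (set (nat * nat))) :
  is_coarse_structure EE -> locally_finite EE -> ~ coarse_bounded EE setT.
Proof.
by move=> cEE lfEE /(locally_finite_boundedP _ cEE lfEE); exact: infinite_nat.
Qed.

Lemma finite_entourage_image (EE : set (set (nat * nat))) E (A : set nat) :
  locally_finite EE -> EE E -> finite_set A -> finite_set (entourage_image E A).
Proof. by move=> lfEE EEE finA; apply: bigcup_finite => // x _; exact: lfEE. Qed.

(** The finitely many missing points can be added to a ball around a point
    of A. *)
Lemma coarse_large_cofinite (EE : set (set (nat * nat))) E (A : set nat) N :
  is_coarse_structure EE -> EE E -> A !=set0 ->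
  (forall x, N <= x -> entourage_image E A x) -> coarse_large EE A.
Proof.
move=> cEE EEE [a Aa] EA; have [F EEF FN] := coarse_segment a N cEE.
have [T EET EFT] := coarse_union cEE EEE EEF.
exists T => //; apply/seteqP; split=> // x _.
have [/EA|ltxN] := leqP N x.
  by apply: sub_entourage_image => p Ep; apply: EFT; left.
by apply/mem_entourage_image; exists a => //; apply: EFT; right; exact: FN.
Qed.

Lemma large_inseparated (X : Type) (EE : set (set (X * X))) :
  is_coarse_structure EE -> large EE -> inseparated EE.
Proof.
move=> cEE [ubX lgX]; split=> // -[A [B [ubA ubB sep]]].
have [E EEE EA] := lgX A ubA.
have [F EEF [x]] := sep _ EEE; rewrite EA setTI => EBF.
apply: ubB; exists F => //; exists x; apply: subset_trans EBF => b Bb.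
by apply/mem_entourage_image; exists b => //; apply: coarse_refl EEE.
Qed.

(** The two halves B, C of an infinite discrete set would be separated: a point
    of both E[B] and E[C] is close to a point of B that has a point of C in its
    E E^-1 neighbourhood, and there are finitely many of those. *)
Lemma inseparated_indiscrete (EE : set (set (nat * nat))) :
  is_coarse_structure EE -> locally_finite EE -> inseparated EE -> indiscrete EE.
Proof.
move=> cEE lfEE [ubX insep]; split=> // A discA.
have bP B := locally_finite_boundedP B cEE lfEE.
apply/bP; apply: contrapT => infA; apply: insep.
have [B [C [infB infC DE BC0]]] := infinite_set_split infA.
exists B, C; split; [by move/bP|by move/bP|].
move=> E EEE; apply/bP.
have [E' EEE' EE'] := coarse_symmetrize cEE EEE.
have [T EET ET] := coarse_comp cEE EEE EEE'.
have /bP fin := discA _ EET.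
apply: sub_finite_set (finite_entourage_image lfEE EEE fin).
move=> z [/mem_entourage_image[b Bb Ebz] /mem_entourage_image[c Cc Ecz]].
apply/mem_entourage_image; exists b => //; split; first by rewrite DE; left.
have bc : b <> c.
  by move=> bc; have : (B `&` C) b; [split; rewrite // bc|rewrite BC0].
move=> Tb; apply: bc; suff : [set b] c by [].
rewrite -Tb; split; first by rewrite DE; right.
by apply/xsectionP; apply: ET Ebz (proj2 (EE' _ _ Ecz)).
Qed.

Definition controls (E : set (nat * nat)) (f : nat -> nat) :=
  {homo f : x y / x <= y} /\
  forall x y, E (x, y) -> y <= f x /\ x <= f y.

(** The maximum, over the initial segment up to x, of the finite sections of a
    symmetric entourage containing E. *)
Lemma locally_finite_control (EE : set (set (nat * nat))) :
  is_coarse_structure EE -> locally_finite EE ->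
  exists f, forall E, EE E -> controls E (f E).
Proof.
move=> cEE lfEE.
suff /choice[f fP] E : exists f, EE E -> controls E f by exists f.
have [EEE|nE] := pselect (EE E); last by exists id => /nE.
have [T EET ET] := coarse_symmetrize cEE EEE.
have /choice[b bP] x : exists n, forall y, T (x, y) -> y <= n.
  have /finite_nat_bound[n nP] := lfEE _ x EET.
  by exists n => y Txy; apply/nP/xsectionP.
exists (fun x => \max_(i < x.+1) b i) => _; split.
  move=> x y lexy; apply/bigmax_leqP => i _.
  by apply: (leq_bigmax (widen_ord _ i)).
by move=> x y /ET[/bP Txy /bP Tyx]; split; apply: leq_trans (leq_bigmax ord_max).
Qed.

(** If g bounded all the controls, a set whose gaps outgrow g would be discrete,
    hence finite: a point linked to a larger one by E violates the gap at once,
    and a point linked to a smaller y does so unless y is one of the finitely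
    many arguments at which g is not yet above the control of E. *)
Lemma control_unbounded (EE BB : set (set (nat * nat))) f :
  is_coarse_structure EE -> locally_finite EE -> indiscrete EE ->
  (forall E, EE E -> controls E (f E)) ->
  is_base EE BB -> unbounded_family (f @` BB).
Proof.
move=> cEE lfEE [_ indisc] fP [BBE baseB] [g gP].
have bP B := locally_finite_boundedP B cEE lfEE.
have [A infA sparseA] := sparse_set g.
apply/infA/bP/indisc => E EEE; have [B BBB EB] := baseB _ EEE.
have [fmon fB] := fP _ (BBE _ BBB).
have [N gN] : eventually_le (f B) g by apply: gP; exists B.
apply/bP/finite_nat_bound; exists (maxn N (f B N)) => x [Ax nAE].
apply: contrapT => /negP; rewrite -ltnNge gtn_max => /andP[ltNx ltfx].
apply: nAE; apply/seteqP; split=> [y [Ay /xsectionP/EB/fB[yf xf]]|_ ->]; last first.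
  by split=> //; apply/xsectionP; exact: coarse_refl EEE.
have [ltyx|ltxy|//] := ltngtP y x.
  have [leNy|/ltnW/fmon leyN] := leqP N y.
    have := leq_ltn_trans (leq_trans xf (gN _ leNy)) (sparseA _ _ Ay Ax ltyx).
    by rewrite ltnn.
  by have := leq_ltn_trans (leq_trans xf leyN) ltfx; rewrite ltnn.
have := leq_ltn_trans (leq_trans yf (gN _ (ltnW ltNx))) (sparseA _ _ Ax Ay ltxy).
by rewrite ltnn.
Qed.

Lemma indiscrete_base_infinite (EE BB : set (set (nat * nat))) :
  is_coarse_structure EE -> locally_finite EE -> indiscrete EE ->
  is_base EE BB -> infinite_set BB.
Proof.
move=> cEE lfEE indisc baseB finB.
have [f fP] := locally_finite_control cEE lfEE.
have := control_unbounded cEE lfEE indisc fP baseB.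
by move/unbounded_family_infinite; apply; exact: finite_image.
Qed.

(** Let A have gaps outgrowing h and E[A] = X, and let f control E.  The point
    x = f(n) + 1 lies in E(a) for some a in A.  No a <= n is possible, so either
    x is beyond the next point m of A after n, or a >= m; in both cases
    F(n) = f(f(n) + 1) >= m.  Hence F(F(n)) is at least the second point of A
    after n, which exceeds h(n). *)
Lemma control_dominating (EE BB : set (set (nat * nat))) f :
  is_coarse_structure EE -> locally_finite EE -> large EE ->
  (forall E, EE E -> controls E (f E)) -> is_base EE BB ->
  dominating_family
    ((fun E n => let F m := f E (f E m).+1 in F (F n)) @` BB).
Proof.
move=> cEE lfEE [_ lg] fP [BBE baseB] h.
have bP B := locally_finite_boundedP B cEE lfEE.
(* The gaps outgrow the maxima of h on initial segments, since the n at which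
   h(n) is to be bounded need not be in A. *)
have [A infA sparseA] := sparse_set (fun n => \max_(i < n.+1) h i).
have [E EEE EA] : coarse_large EE A by apply: lg => /bP.
have [B BBB EB] := baseB _ EEE; have [fmon fB] := fP _ (BBE _ BBB).
set F := fun m => f B (f B m).+1.
exists (fun n => F (F n)); first by exists B.
exists 0 => n _.
have fge x : x <= f B x by have [] := fB x x (coarse_refl x cEE (BBE _ BBB)).
have Fnext m : exists2 a, A a & m < a <= F m.
  have /infinite_nat_unbounded/(_ m)[a0 Aa0 lta0] := infA.
  have exa : exists a, `[< A a >] && (m < a).
    by exists a0; rewrite lta0 andbT; apply/asboolP.
  case: (ex_minnP exa) => a /andP[/asboolP Aa lta] mina.
  exists a; rewrite // lta /=.
  have [lt|] := ltnP (f B m).+1 a; last by move/leq_trans; apply; exact: fge.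
  have /mem_entourage_image[c Ac /EB/fB[fc cf]] : entourage_image E A (f B m).+1.
    by rewrite EA.
  have [lecm|ltmc] := leqP c m.
    by have := leq_trans fc (fmon _ _ lecm); rewrite ltnn.
  by apply: leq_trans cf; apply: mina; rewrite ltmc andbT; apply/asboolP.
have [a Aa /andP[lta leF]] := Fnext n.
have [b Ab /andP[ltb leF']] := Fnext a.
have Fmon : {homo F : x y / x <= y}.
  by move=> x y /fmon le; apply: fmon.
apply: leq_trans (Fmon _ _ leF); apply: leq_trans leF'; apply: ltnW.
apply: leq_ltn_trans (sparseA _ _ Aa Ab ltb).
have ltna : n < a.+1 by apply: leq_trans lta _.
exact: (leq_bigmax (Ordinal ltna)).
Qed.

(** * Generated coarse structures *)

(** Neighbouring integers are linked whatever R is, so that words connect any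
    two points. *)
Definition link (R : nat -> nat -> Prop) (x y : nat) : Prop :=
  [\/ R x y, R y x | (x <= y.+1) && (y <= x.+1)].

Lemma link_sym R x y : link R x y -> link R y x.
Proof. by case=> [?|?|]; [constructor 2|constructor 1|constructor 3; rewrite andbC]. Qed.

Lemma link_refl R x : link R x x.
Proof. by constructor 3; rewrite leqnSn. Qed.

Fixpoint reach (T : Type) (K : T -> nat -> nat -> Prop) (w : seq T) (x y : nat)
    : Prop :=
  if w is s :: w' then exists2 z, link (K s) x z & reach K w' z y else x = y.

Definition generated (T : Type) (S : set T) (K : T -> nat -> nat -> Prop)
    : set (set (nat * nat)) :=
  [set E | is_entourage E /\
    exists2 w, words S w & forall x y, E (x, y) -> reach K w x y].

Lemma reach_refl (T : Type) (K : T -> nat -> nat -> Prop) w x :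
  reach K w x x.
Proof. by elim: w => //= s w IH; exists x => //; exact: link_refl. Qed.

Lemma reach_cat (T : Type) (K : T -> nat -> nat -> Prop) v w x y z :
  reach K v x y -> reach K w y z -> reach K (v ++ w) x z.
Proof.
elim: v x => [|s v IH] x /= => [->//|[t xt ty] yz].
by exists t => //; exact: IH.
Qed.

Lemma reach_rev (T : Type) (K : T -> nat -> nat -> Prop) w x y :
  reach K w x y -> reach K (rev w) y x.
Proof.
elim: w x => [|s w IH] x /= => [->//|[t xt /IH yt]].
rewrite rev_cons -cats1; apply: reach_cat yt _ => /=.
by exists x => //; exact: link_sym.
Qed.

Lemma reach_nseq (T : Type) (K : T -> nat -> nat -> Prop) s x n :
  reach K (nseq n s) x (x + n).
Proof.
elim: n x => [|n IH] x /=; first by rewrite addn0.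
exists x.+1; last by rewrite addnS -addSn; exact: IH.
by constructor 3; rewrite leqnn leqW.
Qed.

Lemma words_cat (T : Type) (S : set T) v w :
  words S v -> words S w -> words S (v ++ w).
Proof. by elim: v => //= x v IH [Sx Sv] Sw; split=> //; exact: IH. Qed.

Lemma words_rev (T : Type) (S : set T) w : words S w -> words S (rev w).
Proof.
elim: w => //= x w IH [Sx Sw]; rewrite rev_cons -cats1.
by apply: words_cat => //; exact: IH.
Qed.

Lemma generated_coarse (T : Type) (S : set T) K :
  S !=set0 -> is_coarse_structure (generated S K).
Proof.
move=> [s Ss]; split.
- by move=> E [].
- apply/seteqP; split=> // -[x y] _.
  exists [set p | p.1 = p.2 \/ p = (x, y)]; last by right.
  split; first by move=> _ [z _ <-]; left.
  have [lexy|/ltnW leyx] := leqP x y.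
    exists (nseq (y - x) s); first exact: words_nseq.
    move=> u v [/= ->|[-> ->]]; first exact: reach_refl.
    by rewrite -{2}(subnKC lexy); exact: reach_nseq.
  exists (rev (nseq (x - y) s)); first by apply/words_rev/words_nseq.
  move=> u v [/= ->|[-> ->]]; first exact: reach_refl.
  by apply: reach_rev; rewrite -{2}(subnKC leyx); exact: reach_nseq.
- move=> E F [Ee [v Sv Ev]] [Fe [w Sw Fw]].
  exists [set p | reach K (v ++ rev w) p.1 p.2].
    split; first by move=> _ [x _ <-]; exact: reach_refl.
    by exists (v ++ rev w) => //; apply: words_cat => //; exact: words_rev.
  by move=> [x z] /= [y /Ev xy /Fw zy]; apply: reach_cat xy _; exact: reach_rev.
- move=> E F [_ [w Sw Ew]] Fe FE; split=> //; exists w => // x y /FE.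
  exact: Ew.
Qed.

(** The relations [reach K w], for words w over S, form a base. *)
Lemma generated_weight (T : Type) (S : set T) K :
  infinite_set S -> weight (generated S K) #<= S.
Proof.
move=> infS; pose BB := (fun w => [set p | reach K w p.1 p.2]) @` words S.
have baseBB : is_base (generated S K) BB.
  split.
    move=> _ [w Sw <-]; split; last by exists w.
    by move=> _ [x _ <-]; exact: reach_refl.
  move=> E [_ [w Sw Ew]]; exists [set p | reach K w p.1 p.2]; first by exists w.
  by move=> [x y] /Ew.
exact: card_le_trans ((weightP _).2 _ baseBB) (card_le_trans (card_image_le _ _) (card_words infS)).
Qed.

Lemma generated_letter (T : Type) (S : set T) K s : S s ->
  exists2 E, generated S K E & forall x y, K s x y -> E (x, y) /\ E (y, x).
Proof.
move=> Ss; exists [set p | reach K [:: s] p.1 p.2].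
  split; first by move=> _ [x _ <-]; exact: reach_refl.
  by exists [:: s].
move=> x y Kxy; split; first by exists y => //; constructor 1.
by exists x => //; constructor 2.
Qed.

Lemma xsection_reach (T : Type) (K : T -> nat -> nat -> Prop) E w x :
  (forall x y, E (x, y) -> reach K w x y) -> xsection E x `<=` [set y | reach K w x y].
Proof. by move=> Ew y /xsectionP/Ew. Qed.

Lemma reach_cons (T : Type) (K : T -> nat -> nat -> Prop) s w x :
  [set y | reach K (s :: w) x y] =
  \bigcup_(z in [set z | link (K s) x z]) [set y | reach K w z y].
Proof. by []. Qed.

Lemma sub_link R x : [set y | link R x y] `<=`
  [set y | R x y] `|` [set y | R y x] `|` [set y | (x <= y.+1) && (y <= x.+1)].
Proof. by move=> y [?|?|?]; [left; left|left; right|right]. Qed.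

Lemma card_le_neighbours x : [set y | (x <= y.+1) && (y <= x.+1)] #<= `I_3.
Proof.
apply: (card_le_inj (f := fun y => y.+1 - x)).
  by move=> y /andP[lexy leyx]; rewrite /= ltnS leq_subLR addn2 ltnS.
move=> y z /andP[lexy _] /andP[lexz _] yz; apply: succn_inj.
by rewrite -(subnK lexy) yz subnK.
Qed.

Lemma generated_locally_finite (T : Type) (S : set T) K :
  (forall s, S s -> forall x, finite_set [set y | K s x y] /\
                              finite_set [set y | K s y x]) ->
  locally_finite (generated S K).
Proof.
move=> finK E x [_ [w Sw Ew]]; apply: sub_finite_set (xsection_reach Ew) _.
elim: w x Sw {Ew} => [x _|s w IH x [Ss Sw]].
  exact: (sub_finite_set _ (finite_set1 x)).
rewrite reach_cons; apply: bigcup_finite; last by move=> z _; exact: IH.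
apply: sub_finite_set (@sub_link _ _) _; rewrite !finite_setU.
have [? ?] := finK _ Ss x; split=> //.
by apply/finite_set_leP; exists 3; exact: card_le_neighbours.
Qed.

(** An element u of F i is numbered by the pair of the number of i in A and of
    the number of u in F i. *)
Lemma card_le_bigcup_II (T U : Type) (A : set T) (F : T -> set U) m n :
  A #<= `I_m -> (forall i, A i -> F i #<= `I_n) ->
  \bigcup_(i in A) F i #<= `I_(m * n).
Proof.
case: n => [|n] Am Fn.
  rewrite muln0; suff -> : \bigcup_(i in A) F i = set0 by exact: card_ge0.
  apply/seteqP; split=> // u [i Ai Fiu]; have := Fn _ Ai.
  by rewrite II0 => /card_le0P E; rewrite E in Fiu.
case: m Am => [|m] Am.
  move: Am; rewrite II0 => /card_le0P ->; rewrite bigcup_set0; exact: card_ge0.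
have [|e [eI einj]] := card_le_injP _ Am; first by exists 0.
have /choice[c cP] i : exists c : U -> nat, A i ->
    (forall u, F i u -> c u < n.+1) /\
    (forall u v, F i u -> F i v -> c u = c v -> u = v).
  have [/Fn Fin|nA] := pselect (A i); last by exists (fun=> 0) => /nA.
  have [|c [cI cinj]] := card_le_injP _ Fin; first by exists 0.
  by exists c.
have [[i0 Ai0]|nA] := pselect (A !=set0); last first.
  suff -> : \bigcup_(i in A) F i = set0 by exact: card_ge0.
  by apply/seteqP; split=> // u [i Ai _]; apply: nA; exists i.
have /choice[l lP] u : exists i, (\bigcup_(i in A) F i) u -> A i /\ F i u.
  have [[i Ai Fiu]|nu] := pselect ((\bigcup_(i in A) F i) u); first by exists i.
  by exists i0 => /nu.
apply: (card_le_inj (f := fun u => e (l u) * n.+1 + c (l u) u)).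
  move=> u /lP[Al Fu]; have /(_ _ Fu) ltc := (cP _ Al).1.
  have := eI _ Al; rewrite /= => lte; apply: leq_trans (_ : e (l u) * n.+1 + n.+1 <= _).
    by rewrite ltn_add2l.
  by rewrite -mulSnr leq_mul2r.
move=> u v /lP[Au Fu] /lP[Av Fv] uv.
have ltu := (cP _ Au).1 _ Fu; have ltv := (cP _ Av).1 _ Fv.
have luv : l u = l v.
  apply: einj => //; have := congr1 (divn^~ n.+1) uv.
  by rewrite /= !divnMDl // !divn_small // !addn0.
apply: (cP _ Au).2 => //; first by rewrite luv.
by move/eqP: uv; rewrite -luv eqn_add2l => /eqP.
Qed.

Lemma card_le_setU_II (T : Type) (A B : set T) m n :
  A #<= `I_m -> B #<= `I_n -> A `|` B #<= `I_(2 * maxn m n).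
Proof.
move=> Am Bn; rewrite -(bigcup2E A B).
have -> : \bigcup_i bigcup2 A B i = \bigcup_(i in `I_2) bigcup2 A B i.
  by rewrite bigcup2inE bigcup2E.
apply: card_le_bigcup_II => [|[_|[_|//]]]; first exact: card_lexx.
  by apply: card_le_trans Am _; rewrite card_le_II leq_maxl.
by apply: card_le_trans Bn _; rewrite card_le_II leq_maxr.
Qed.

Lemma generated_finitary (T : Type) (S : set T) K :
  (forall s, S s -> exists n, forall x, [set y | K s x y] #<= `I_n /\
                                        [set y | K s y x] #<= `I_n) ->
  finitary (generated S K).
Proof.
move=> finK E [_ [w Sw Ew]].
suff [n nP] : exists n, forall x, [set y | reach K w x y] #<= `I_n.
  exists n => x; apply: card_le_trans (nP x); apply: subset_card_le.
  exact: xsection_reach.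
elim: w Sw {Ew} => [_|s w IH [Ss /IH[n nP]]].
  exists 1 => x; apply: (card_le_inj (f := fun=> 0)) => [y|y z] //=.
  by move=> <- <-.
have [m mP] := finK _ Ss.
exists (2 * maxn (2 * maxn m m) 3 * n) => x; rewrite reach_cons.
apply: card_le_bigcup_II => //.
have [mx mx'] := mP x.
apply: card_le_trans (subset_card_le (@sub_link _ _)) _.
exact: card_le_setU_II (card_le_setU_II mx mx') (card_le_neighbours x).
Qed.

(** * Structures generated by functions *)

Definition interval_link (f : nat -> nat) (x y : nat) : Prop := x <= y <= f x.

Lemma interval_locally_finite (H : set (nat -> nat)) :
  locally_finite (generated H interval_link).
Proof.
apply: generated_locally_finite => f _ x; split; apply/finite_nat_bound.
  by exists (f x) => y /andP[].
by exists x => y /andP[].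
Qed.

(** Let g(n) bound a point a of A and a point b of B beyond n, and let f exceed
    g infinitely often.  Whenever f(n) > g(n), the point n is linked by f to
    both a and b, so it lies in E[A] and in E[B]. *)
Lemma unbounded_inseparated (H : set (nat -> nat)) : unbounded_family H ->
  inseparated (generated H interval_link).
Proof.
move=> unbH; have infH := unbounded_family_infinite unbH.
have cEE := generated_coarse interval_link (infinite_setN0 infH).
have lfEE := @interval_locally_finite H.
have bP B := locally_finite_boundedP B cEE lfEE.
split; first exact: locally_finite_unbounded.
move=> [A [B [/bP infA /bP infB sep]]]; apply: unbH.
have /choice[g gP] n : exists m, exists a b,
    [/\ A a, B b, n <= a <= m & n <= b <= m].
  have /infinite_nat_unbounded/(_ n)[a Aa /ltnW na] := infA.
  have /infinite_nat_unbounded/(_ n)[b Bb /ltnW nb] := infB.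
  by exists (maxn a b), a, b; rewrite na nb leq_maxl leq_maxr.
exists g => f Hf; have [E EEE fE] := generated_letter interval_link Hf.
have /bP/finite_nat_bound[N EN] := sep _ EEE.
exists N.+1 => n ltNn; rewrite leqNgt; apply/negP => ltgf.
have [a [b [Aa Bb /andP[na ag] /andP[nb bg]]]] := gP n.
have : n <= N; last by rewrite leqNgt ltNn.
apply: EN; split; apply/mem_entourage_image.
  exists a => //; apply: (fE _ _ _).2.
  by rewrite /interval_link na (leq_trans ag (ltnW ltgf)).
exists b => //; apply: (fE _ _ _).2.
by rewrite /interval_link nb (leq_trans bg (ltnW ltgf)).
Qed.

(** If f eventually dominates the function sending n to a point of A beyond n,
    then f links almost every n to a point of A. *)
Lemma dominating_large (H : set (nat -> nat)) : dominating_family H ->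
  large (generated H interval_link).
Proof.
move=> domH.
have infH := unbounded_family_infinite (dominating_unbounded domH).
have cEE := generated_coarse interval_link (infinite_setN0 infH).
have lfEE := @interval_locally_finite H.
have bP B := locally_finite_boundedP B cEE lfEE.
split=> [|A /bP infA]; first exact: locally_finite_unbounded.
have /choice[g gP] n : exists m, A m /\ n <= m.
  have /infinite_nat_unbounded/(_ n)[m Am /ltnW nm] := infA.
  by exists m.
have [f Hf [N gf]] := domH g.
have [E EEE fE] := generated_letter interval_link Hf.
apply: (coarse_large_cofinite (N := N) cEE EEE (infinite_setN0 infA)) => x Nx.
have [Ag xg] := gP x; apply/mem_entourage_image; exists (g x) => //.
by apply: (fE _ _ _).2; rewrite /interval_link xg gf.
Qed.

Definition graph_link (h : nat -> nat) (x y : nat) : Prop := h x = y.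

Lemma graph_finitary (H : set (nat -> nat)) : H `<=` [set h | injective h] ->
  finitary (generated H graph_link).
Proof.
move=> Hinj; apply: generated_finitary => h /Hinj hinj; exists 1 => x.
split; apply: (card_le_inj (f := fun=> 0)) => // y z.
  by rewrite /graph_link /= => <- <-.
by rewrite /graph_link /= => <- /hinj.
Qed.

(** Number the points of each section E(x) and of each section of the inverse.
    The pairs (x, y) of E such that y has number i in E(x) and x has number j in
    the inverse section of y form the graph of a partial injection, for i fixed
    determines y from x and j fixed determines x from y; there are finitely many
    pairs (i, j). *)
Lemma entourage_bijections (EE : set (set (nat * nat))) E :
  is_coarse_structure EE -> finitary EE -> EE E ->
  exists H : set (nat -> nat), [/\ finite_set H, H `<=` [set h | bijective h]
    & forall x y, E (x, y) -> exists2 h, H h & h x = y].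
Proof.
move=> cEE finEE EEE; have [T EET ET] := coarse_symmetrize cEE EEE.
have [n nP] := finEE _ EEE; have [m mP] := finEE _ EET.
have code (F : set (nat * nat)) k : (forall x, xsection F x #<= `I_k) ->
    exists e : nat -> nat -> nat, forall x, (forall y, F (x, y) -> e x y < k.+1) /\
      (forall y z, F (x, y) -> F (x, z) -> e x y = e x z -> y = z).
  move=> kP.
  suff /choice[e eP] x : exists e : nat -> nat,
      (forall y, F (x, y) -> e y < k.+1) /\
      (forall y z, F (x, y) -> F (x, z) -> e y = e z -> y = z) by exists e.
  have [||e [eI einj]] := @card_le_injP _ _ (xsection F x) `I_k.+1.
  - by exists 0.
  - by apply: card_le_trans (kP x) _; rewrite card_le_II.
  exists e; split=> [y Fxy|y z Fxy Fxz]; first by apply: eI; apply/xsectionP.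
  by apply: einj; apply/xsectionP.
have [e eP] := code _ _ nP; have [d dP] := code _ _ mP.
have /choice[h1 /choice[h2 hP]] (p : nat * nat) : exists h1 h2 : nat -> nat,
    [/\ bijective h1, bijective h2 & forall x y, E (x, y) ->
      e x y = p.1 -> d y x = p.2 -> h1 x = y \/ h2 x = y].
  pose D := [set x | exists y, [/\ E (x, y), e x y = p.1 & d y x = p.2]].
  have /choice[f fP] x : exists y, D x ->
      [/\ E (x, y), e x y = p.1 & d y x = p.2].
    have [[y yP]|nD] := pselect (D x); first by exists y.
    by exists 0 => /nD.
  have [|h1 [h2 [h1b h2b hf]]] := @partial_injection_cover D f.
    move=> x y /fP[Ex _ dx] /fP[Ey _ dy] fxy.
    apply: (dP (f x)).2; [exact: (ET _ _ Ex).2| |by rewrite dx fxy dy].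
    by rewrite fxy; exact: (ET _ _ Ey).2.
  exists h1, h2; split=> // x y Exy ex dy.
  have Dx : D x by exists y.
  have [Ef ef _] := fP _ Dx; suff <- : f x = y by exact: hf.
  by apply: (eP x).2 => //; rewrite ef ex.
exists (\bigcup_(p in `I_n.+1 `*` `I_m.+1) [set h1 p; h2 p]); split.
- by apply: bigcup_finite => *; [exact: finite_setX|exact: finite_set2].
- by move=> _ [p _ [->|->]]; have [] := hP p.
- move=> x y Exy; pose p := (e x y, d y x).
  have pI : (`I_n.+1 `*` `I_m.+1) p.
    by split; [exact: (eP x).1|apply: (dP y).1; exact: (ET _ _ Exy).2].
  have [_ _ /(_ _ _ Exy erefl erefl)[hx|hx]] := hP p.
    by exists (h1 p) => //; exists p => //; left.
  by exists (h2 p) => //; exists p => //; right.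
Qed.

Lemma base_bijections (EE BB : set (set (nat * nat))) :
  is_coarse_structure EE -> finitary EE -> is_base EE BB -> infinite_set BB ->
  exists H : set (nat -> nat), [/\ H #<= BB, H `<=` [set h | bijective h]
    & forall E, EE E -> exists H', [/\ finite_set H', H' `<=` H
      & forall x y, E (x, y) -> exists2 h, H' h & h x = y]].
Proof.
move=> cEE finEE [BBE baseB] infBB.
have /choice[F FP] B : exists H : set (nat -> nat), EE B ->
    [/\ finite_set H, H `<=` [set h | bijective h]
      & forall x y, B (x, y) -> exists2 h, H h & h x = y].
  have [/(entourage_bijections cEE finEE)[H HP]|nB] := pselect (EE B).
    by exists H.
  by exists set0 => /nB.
exists (\bigcup_(B in BB) F B); split.
- apply: card_le_bigcup_countable => // B /BBE/FP[finF _ _].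
  exact: finite_set_countable.
- by move=> h [B /BBE/FP[_ Fb _]]; exact: Fb.
- move=> E /baseB[B BBB EB]; have [finF Fb FB] := FP _ (BBE _ BBB).
  by exists (F B); split=> // [|x y /EB/FB//]; exact: bigcup_sup.
Qed.

Definition Delta_family (H : set (nat -> nat)) : Prop :=
  H `<=` [set h | bijective h] /\
  forall A, infinite_set A -> exists2 h, H h &
    infinite_set [set a | [/\ A a, a <> h a & A (h a)]].

Definition Sigma_family (H : set (nat -> nat)) : Prop :=
  H `<=` [set h | bijective h] /\
  forall A B, infinite_set A -> infinite_set B ->
    exists2 h, H h & infinite_set (h @` A `&` B).

(** An infinite A is not discrete, so for some E infinitely many points of A
    have another point of A in their E-section.  Finitely many permutations
    cover E, and one of them accounts for infinitely many of these points. *)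
Lemma indiscrete_base_Delta (EE BB : set (set (nat * nat))) :
  is_coarse_structure EE -> finitary EE -> indiscrete EE -> is_base EE BB ->
  exists2 H, Delta_family H & H #<= BB.
Proof.
move=> cEE finEE indisc baseB; have lfEE := finitary_locally_finite finEE.
have infBB := indiscrete_base_infinite cEE lfEE indisc baseB.
have [H [leH Hb HP]] := base_bijections cEE finEE baseB infBB.
have bP B := locally_finite_boundedP B cEE lfEE.
exists H => //; split=> // A infA; have [_ disc] := indisc.
have [E EEE infE] : exists2 E, EE E &
    infinite_set [set x | A x /\ A `&` xsection E x <> [set x]].
  apply: contrapT => nE; apply/infA/bP/disc => E EEE; apply/bP.
  by apply: contrapT => infE; apply: nE; exists E.
have [H' [finH' H'H H'E]] := HP _ EEE.
have [|h /H'H Hh infh] := @infinite_bigcup _ _ H'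
  (fun h => [set a | [/\ A a, a <> h a & A (h a)]]) _ finH' infE; last by exists h.
move=> x [Ax nAE]; apply: contrapT => nh; apply: nAE; apply/seteqP; split.
  move=> y [Ay /xsectionP/H'E[h H'h hxy]] /=; apply: contrapT => nyx.
  by apply: nh; exists h => //; split=> //; rewrite hxy // => /esym.
by move=> _ ->; split=> //; apply/xsectionP; exact: coarse_refl EEE.
Qed.

(** If E[A] and E[B] have infinitely many common points, then infinitely many
    points of B are linked to A by E E^-1, because sections are finite. *)
Lemma inseparated_base_Sigma (EE BB : set (set (nat * nat))) :
  is_coarse_structure EE -> finitary EE -> inseparated EE -> is_base EE BB ->
  exists2 H, Sigma_family H & H #<= BB.
Proof.
move=> cEE finEE insep baseB; have lfEE := finitary_locally_finite finEE.
have indisc := inseparated_indiscrete cEE lfEE insep.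
have infBB := indiscrete_base_infinite cEE lfEE indisc baseB.
have [H [leH Hb HP]] := base_bijections cEE finEE baseB infBB.
have bP B := locally_finite_boundedP B cEE lfEE.
exists H => //; split=> // A B infA infB; have [_ nsep] := insep.
have [E EEE infE] : exists2 E, EE E &
    infinite_set (entourage_image E A `&` entourage_image E B).
  apply: contrapT => nE; apply: nsep; exists A, B; split; [by move/bP|by move/bP|].
  move=> E EEE; apply/bP.
  by apply: contrapT => infE; apply: nE; exists E.
have [T EET ET] := coarse_quotient cEE EEE EEE.
have [H' [finH' H'H H'T]] := HP _ EET.
pose B' := [set b | B b /\ exists2 a, A a & T (a, b)].
have infB' : infinite_set B'.
  move=> finB'; apply: infE.
  apply: sub_finite_set (finite_entourage_image lfEE EEE finB').
  move=> z [/mem_entourage_image[a Aa Eaz] /mem_entourage_image[b Bb Ebz]].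
  apply/mem_entourage_image; exists b => //; split=> //; exists a => //.
  exact: ET Eaz Ebz.
have [|h /H'H Hh infh] := @infinite_bigcup _ _ H' (fun h => h @` A `&` B) _
  finH' infB'; last by exists h.
move=> b [Bb [a Aa /H'T[h H'h hab]]]; exists h => //; split=> //; by exists a.
Qed.

(** Apply the property to the two halves of A. *)
Lemma Sigma_Delta H : Sigma_family H -> Delta_family H.
Proof.
move=> [Hb HS]; split=> // A /infinite_set_split[B [C [infB infC -> BC0]]].
have [h Hh infh] := HS _ _ infB infC; exists h => // fin; apply: infh.
apply: sub_finite_set (finite_image h fin) => _ [[b Bb <-] Chb].
exists b => //; split; [by left| |by right].
by move=> bhb; have : (B `&` C) b; [split; rewrite // bhb|rewrite BC0].
Qed.

(** For a finite family, a set whose gaps outgrow all its members and their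
    inverses contains no a with h(a) in it and different from a. *)
Lemma Delta_infinite H : Delta_family H -> infinite_set H.
Proof.
move=> [Hb HD] finH.
have /choice[inv invP] (h : nat -> nat) : exists k, H h -> cancel h k.
  have [/Hb[k hk _]|nH] := pselect (H h); first by exists k.
  by exists id => /nH.
have [g1 g1P] := finite_family_bounded finH.
have [g2 g2P] := finite_family_bounded (finite_image inv finH).
have [A infA sparseA] := sparse_set (fun n => maxn (g1 n) (g2 n)).
have [h Hh /infinite_setN0[a [Aa nha Aha]]] := HD _ infA.
have [lt|lt|/nha//] := ltngtP a (h a).
  have := leq_ltn_trans (leq_maxl _ _) (sparseA _ _ Aa Aha lt).
  by rewrite ltnNge g1P.
have := leq_ltn_trans (leq_maxr _ _) (sparseA _ _ Aha Aa lt).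
by rewrite ltnNge -{1}(invP _ Hh a) g2P //; exists h.
Qed.

Lemma bijective_finitary (H : set (nat -> nat)) : H `<=` [set h | bijective h] ->
  finitary (generated H graph_link).
Proof. by move=> Hb; apply: graph_finitary => h /Hb/bij_inj. Qed.

Lemma Delta_indiscrete H : Delta_family H -> indiscrete (generated H graph_link).
Proof.
move=> DH; have infH := Delta_infinite DH; have [Hb HD] := DH.
have cEE := generated_coarse graph_link (infinite_setN0 infH).
have lfEE := finitary_locally_finite (bijective_finitary Hb).
have bP B := locally_finite_boundedP B cEE lfEE.
split=> [|A discA]; first exact: locally_finite_unbounded.
apply/bP; apply: contrapT => infA; have [h Hh infh] := HD _ infA.
have [E EEE hE] := generated_letter graph_link Hh.
have /bP fin := discA _ EEE; apply: infh; apply: sub_finite_set fin.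
move=> a [Aa nha Aha]; split=> // AE; apply: nha.
suff : [set a] (h a) by [].
by rewrite -AE; split=> //; apply/xsectionP; exact: (hE _ _ _).1.
Qed.

Lemma Sigma_inseparated H : Sigma_family H -> inseparated (generated H graph_link).
Proof.
move=> SH; have infH := Delta_infinite (Sigma_Delta SH); have [Hb HS] := SH.
have cEE := generated_coarse graph_link (infinite_setN0 infH).
have lfEE := finitary_locally_finite (bijective_finitary Hb).
have bP B := locally_finite_boundedP B cEE lfEE.
split=> [|[A [B [/bP infA /bP infB sep]]]]; first exact: locally_finite_unbounded.
have [h Hh infh] := HS _ _ infA infB.
have [E EEE hE] := generated_letter graph_link Hh.
have /bP fin := sep _ EEE; apply: infh; apply: sub_finite_set fin.
move=> _ [[a Aa <-] Bha]; split; apply/mem_entourage_image.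
  by exists a => //; exact: (hE _ _ _).1.
by exists (h a) => //; exact: coarse_refl EEE.
Qed.

Definition injections : set (nat -> nat) := [set f | injective f].

Lemma injections_infinite : infinite_set injections.
Proof.
apply/infiniteP; apply: (card_le_inj (f := addn)).
  by move=> m _ x y /addnI.
by move=> m n _ _ /(congr1 (fun f => f 0)); rewrite !addn0.
Qed.

(** An enumeration of A links every x to a point of A. *)
Lemma injections_large : large (generated injections graph_link).
Proof.
have cEE := generated_coarse graph_link (infinite_setN0 injections_infinite).
have lfEE := finitary_locally_finite (@graph_finitary injections (fun _ => id)).
have bP B := locally_finite_boundedP B cEE lfEE.
split=> [|A /bP infA]; first exact: locally_finite_unbounded.
have [a [Aa ainc]] := sparse_sequence id infA.
have ainj : injections a by apply: increasing_inj => i j /ainc[].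
have [E EEE aE] := generated_letter graph_link ainj.
exists E => //; apply/seteqP; split=> // x _; apply/mem_entourage_image.
by exists (a x) => //; exact: (aE _ _ _).2.
Qed.

(** An injection is determined by its graph, coded as a set of integers. *)
Lemma card_injections : injections #<= cardinal_c.
Proof.
apply: (card_le_inj (f := fun f : nat -> nat => [set pickle (n, f n) | n in setT])).
  by [].
move=> f g _ _ fg; apply/funext => n.
have : [set pickle (n, g n) | n in setT] (pickle (n, f n)) by rewrite -fg; exists n.
by move=> [m _ /(pcan_inj pickleK)[-> ->]].
Qed.

(** The branch of the binary tree given by the characteristic function of s:
    the set of its finite initial segments, coded as integers. *)
Definition branch (s : set nat) : set nat :=
  range (fun n => pickle [seq `[< s i >] | i <- iota 0 n]).

Lemma branch_infinite s : infinite_set (branch s).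
Proof.
apply: infinite_range => m n /(pcan_inj pickleK)/(congr1 size).
by rewrite !size_map !size_iota.
Qed.

(** Once s and t differ at i, they have no common initial segment of length
    greater than i. *)
Lemma branch_almost_disjoint s t : s <> t -> finite_set (branch s `&` branch t).
Proof.
move=> nst; have [i sti] : exists i, ~ (s i <-> t i).
  apply: contrapT => ni; apply: nst; apply/funext => i; apply/propext.
  by apply: contrapT => sti; apply: ni; exists i.
apply: sub_finite_set
  (finite_image (fun n => pickle [seq `[< s i >] | i <- iota 0 n]) (finite_II i.+1)).
move=> _ [[n _ <-] [m _ /(pcan_inj pickleK) E]]; exists n => //=.
have nm : n = m by move/(congr1 size): E; rewrite !size_map !size_iota.
rewrite ltnS leqNgt; apply/negP => ltin; apply: sti.
have := congr1 (fun w => nth false w i) E.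
rewrite -nm !(nth_map 0) ?size_iota // nth_iota // => /esym.
exact: asbool_eq_equiv.
Qed.

(** Let the inverse sections of E have at most n points, and suppose that n + 1
    branches satisfy E[A] = X.  Each x has in its inverse section a point of each
    of them, so by the pigeonhole principle a point common to two of them.  Thus
    E[F] = X for the finite set F of the common points, which is absurd. *)
Lemma finitary_branches (EE : set (set (nat * nat))) E :
  is_coarse_structure EE -> finitary EE -> EE E ->
  finite_set [set s | entourage_image E (branch s) = setT].
Proof.
move=> cEE finEE EEE; have [T EET ET] := coarse_symmetrize cEE EEE.
have lfEE := finitary_locally_finite finEE.
have [n nP] := finEE _ EET.
apply: contrapT => infS; have /infiniteP leN := infS.
have [sg [sgE sginj]] := card_le_injP (infinite_setN0 infS) leN.
pose F := \bigcup_(i in `I_n.+1) \bigcup_(j in `I_n.+1 `\ i)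
  (branch (sg i) `&` branch (sg j)).
have finF : finite_set F.
  apply: bigcup_finite => // i _; apply: bigcup_finite; first exact: finite_setD.
  move=> j [_ /= ji]; apply: branch_almost_disjoint => sgij; apply: ji.
  by apply/esym/sginj.
apply: infinite_nat; apply: sub_finite_set (finite_entourage_image lfEE EEE finF).
move=> x _; apply: contrapT => nEF.
have /choice[c cP] i : exists a, branch (sg i) a /\ E (a, x).
  have : entourage_image E (branch (sg i)) x by rewrite (sgE i I).
  by move=> /mem_entourage_image[a]; exists a.
suff : `I_n.+1 #<= `I_n by rewrite card_le_II ltnn.
apply: card_le_trans (nP x); apply: (card_le_inj (f := c)).
  by move=> i _; apply/xsectionP; exact: (ET _ _ (cP i).2).2.
move=> i j iI jI cij; apply: contrapT => nij; apply: nEF.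
apply/mem_entourage_image; exists (c i); last exact: (cP i).2.
exists i => //; exists j; first by split=> // /esym.
by split; [exact: (cP i).1|rewrite cij; exact: (cP j).1].
Qed.

(** Each branch A satisfies E[A] = X for some E in the base, so a base covers
    the c branches by finite sets. *)
Lemma large_base_continuum (EE BB : set (set (nat * nat))) :
  is_coarse_structure EE -> finitary EE -> large EE -> is_base EE BB ->
  cardinal_c #<= BB.
Proof.
move=> cEE finEE lg baseB; have lfEE := finitary_locally_finite finEE.
have insep := large_inseparated cEE lg.
have indisc := inseparated_indiscrete cEE lfEE insep.
have infBB := indiscrete_base_infinite cEE lfEE indisc baseB.
have [BBE baseP] := baseB; have [_ lgE] := lg.
have bP B := locally_finite_boundedP B cEE lfEE.
apply: card_le_trans (card_le_bigcup_countable
  (F := fun B => [set s | entourage_image B (branch s) = setT]) infBB _).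
  apply: subset_card_le => s _.
  have [E EEE Es] : coarse_large EE (branch s).
    by apply: lgE => /bP; exact: branch_infinite.
  have [B BBB EB] := baseP _ EEE; exists B => //; apply/seteqP; split=> // x _.
  by apply: (sub_entourage_image EB); rewrite Es.
move=> B /BBE EEB; apply: finite_set_countable.
exact: finitary_branches cEE finEE EEB.
Qed.

Lemma min_weightP (X : Type) (C : set (set (set (X * X)))) :
  (exists EE, is_coarse_structure EE /\ C EE) ->
  (exists EE, [/\ is_coarse_structure EE, C EE & min_weight C = weight EE]) /\
  forall EE, is_coarse_structure EE -> C EE -> min_weight C #<= weight EE.
Proof.
move=> [EE0 [cEE0 CEE0]].
have [|[EE [cEE CEE] wEE] min] :=
  @min_cardP _ [set weight EE | EE in @is_coarse_structure X `&` C].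
  by exists (weight EE0), EE0.
split; first by exists EE.
by move=> EE' cEE' CEE'; apply: min; exists EE'.
Qed.

(** * The cardinals as smallest weights *)

(** As C is inhabited, its least weight is attained; the lower bound then
    provides a member of P, so that the minimum over P is attained too. *)
Lemma min_card_weight (T X : Type) (P : set (set T))
    (C : set (set (set (X * X)))) :
  (exists EE, is_coarse_structure EE /\ C EE) ->
  (forall EE BB, is_coarse_structure EE -> C EE -> is_base EE BB ->
     exists2 H, P H & H #<= BB) ->
  (forall H, P H ->
     exists EE, [/\ is_coarse_structure EE, C EE & weight EE #<= H]) ->
  min_card P #= min_weight C.
Proof.
move=> C0 lower upper; have [[EE [cEE CEE minE]] minC] := min_weightP C0.
have [H PH leH] := lower _ _ cEE CEE (weightP EE).1.
have [PminP minP] : P (min_card P) /\ forall H, P H -> min_card P #<= H.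
  by apply: min_cardP; exists H.
rewrite card_eq_le minE (card_le_trans (minP _ PH) leH) /=.
have [EE' [cEE' CEE' leEE']] := upper _ PminP.
by apply: card_le_trans leEE'; rewrite -minE; exact: minC.
Qed.

Theorem corollary4p19 :
  (cardinal_b #= min_weight (@locally_finite nat `&` @indiscrete nat)) /\
  (cardinal_b #= min_weight (@locally_finite nat `&` @inseparated nat)) /\
  (cardinal_d #= min_weight (@locally_finite nat `&` @large nat)) /\
  (cardinal_Delta #= min_weight (@finitary nat `&` @indiscrete nat)) /\
  (cardinal_Sigma #= min_weight (@finitary nat `&` @inseparated nat)) /\
  (cardinal_c #= min_weight (@finitary nat `&` @large nat)).
Proof.
pose EE0 := generated injections graph_link.
have cEE0 : is_coarse_structure EE0.
  exact: generated_coarse (infinite_setN0 injections_infinite).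
have finEE0 : finitary EE0 by exact: graph_finitary.
have lfEE0 := finitary_locally_finite finEE0.
have lgEE0 : large EE0 := injections_large.
have insEE0 := large_inseparated cEE0 lgEE0.
have indEE0 := inseparated_indiscrete cEE0 lfEE0 insEE0.
have b_lower (EE BB : set (set (nat * nat))) :
    is_coarse_structure EE -> locally_finite EE -> indiscrete EE ->
    is_base EE BB -> exists2 H, unbounded_family H & H #<= BB.
  move=> cEE lfEE indEE baseB; have [f fP] := locally_finite_control cEE lfEE.
  exists (f @` BB); last exact: card_image_le.
  exact: control_unbounded cEE lfEE indEE fP baseB.
have b_upper H : unbounded_family H ->
    exists EE : set (set (nat * nat)), [/\ is_coarse_structure EE,
    locally_finite EE /\ inseparated EE & weight EE #<= H].
  move=> unbH; have infH := unbounded_family_infinite unbH.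
  exists (generated H interval_link); split; last exact: generated_weight.
    exact: generated_coarse (infinite_setN0 infH).
  by split; [exact: interval_locally_finite|exact: unbounded_inseparated].
do 5?split.
- apply: min_card_weight; first by exists EE0.
    by move=> EE BB cEE [lfEE indEE]; exact: b_lower.
  move=> H /b_upper[EE [cEE [lfEE insEE] wEE]]; exists EE; split=> //; split=> //.
  exact: inseparated_indiscrete.
- apply: min_card_weight; [by exists EE0| |exact: b_upper].
  move=> EE BB cEE [lfEE insEE]; apply: b_lower => //.
  exact: inseparated_indiscrete.
- apply: min_card_weight; first by exists EE0.
    move=> EE BB cEE [lfEE lgEE] baseB.
    have [f fP] := locally_finite_control cEE lfEE.
    have dom := control_dominating cEE lfEE lgEE fP baseB.
    by eexists; [exact: dom|exact: card_image_le].
  move=> H domH; have infH := unbounded_family_infinite (dominating_unbounded domH).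
  exists (generated H interval_link); split; last exact: generated_weight.
    exact: generated_coarse (infinite_setN0 infH).
  by split; [exact: interval_locally_finite|exact: dominating_large].
- apply: min_card_weight; first by exists EE0.
    by move=> EE BB cEE [finEE indEE]; exact: indiscrete_base_Delta.
  move=> H DH; have infH := Delta_infinite DH.
  exists (generated H graph_link); split; last exact: generated_weight.
    exact: generated_coarse (infinite_setN0 infH).
  by split; [exact: bijective_finitary DH.1|exact: Delta_indiscrete].
- apply: min_card_weight; first by exists EE0.
    by move=> EE BB cEE [finEE insEE]; exact: inseparated_base_Sigma.
  move=> H SH; have infH := Delta_infinite (Sigma_Delta SH).
  exists (generated H graph_link); split; last exact: generated_weight.
    exact: generated_coarse (infinite_setN0 infH).
  by split; [exact: bijective_finitary SH.1|exact: Sigma_inseparated].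
- have [|[EE [cEE [finEE lgEE] minE]] minC] :=
    @min_weightP _ (@finitary nat `&` @large nat); first by exists EE0.
  rewrite card_eq_le minE (large_base_continuum cEE finEE lgEE (weightP EE).1) /=.
  rewrite -minE; apply: card_le_trans (minC _ cEE0 (conj finEE0 lgEE0)) _.
  exact: card_le_trans (generated_weight _ injections_infinite) card_injections.
Qed.
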